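(* For $k$ steps of the reorthogonalized joint bidiagonalization (rJBD) process of $\{A,L\}$ (see context), the following relations hold: $$Q_L\widehat V_k=\widehat U_k\widehat B_k,$$ $$Q_L^T\widehat U_k=\widehat V_k(\widehat B_k^T+\widehat D_k)+\hat\beta_k\hat v_{k+1}(e_k^{(k)})^T+\widehat G_k,$$ where $\widehat D_k\in\mathbb{R}^{k\times k}$ is upper triangular, and $$\|\widehat G_k\|=\mathcal{O}(\|\widehat B_k^{-1}\|\sqrt n\,\kappa(C)\tau).$$
   Context: $\|\cdot\|$ is the 2-norm; $e_i^{(r)}$ is the $i$-th column of $I_r$; $0_r$ is the zero vector of $\mathbb{R}^r$. Let $A\in\mathbb{R}^{m\times n}$, $L\in\mathbb{R}^{p\times n}$, $C=\begin{pmatrix}A\\L\end{pmatrix}$ with $\mathrm{rank}(C)=n$, $\kappa(C)=\|C\|\|C^\dagger\|$, and let $C=QR$ be the compact QR factorization, $Q=\begin{pmatrix}Q_A\\Q_L\end{pmatrix}$ with orthonormal columns, $Q_A\in\mathbb{R}^{m\times n}$, $Q_L\in\mathbb{R}^{p\times n}$, $R$ upper triangular and nonsingular. rJBD process with tolerance $\tau$: choose a nonzero starting vector $s_0\in\mathbb{R}^n$, set $\tilde v_1=Cs_0/\|Cs_0\|$, $\beta_0=\hat\beta_0=0$, and for $i=1,\dots,k$: (1) $\alpha_iu_i=\tilde v_i(1:m)-\beta_{i-1}u_{i-1}$, $\|u_i\|=1$; (2) with $\tilde u_i=(u_i^T,0_p^T)^T$, compute an approximate solution $\bar z_i$ of $\min_{\tilde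 z\in\mathbb{R}^n}\|C\tilde z-\tilde u_i\|$ whose residual $\bar r_i=\tilde u_i-C\bar z_i$ satisfies $\|C^T\bar r_i\|/(\|C\|\|\bar r_i\|)\le\tau$; (3) $s_i=C\bar z_i-\alpha_i\tilde v_i$ and $\beta_i\tilde v_{i+1}=s_i-\sum_{j=1}^i(s_i^T\tilde v_j)\tilde v_j$, $\|\tilde v_{i+1}\|=1$; (4) $\hat\alpha_i\hat u_i=(-1)^{i-1}\tilde v_i(m+1:m+p)-\hat\beta_{i-1}\hat u_{i-1}$, $\|\hat u_i\|=1$; $\hat\beta_i=\alpha_i\beta_i/\hat\alpha_i$. All of $\alpha_i,\beta_i,\hat\alpha_i,\hat\beta_i$ are assumed positive during the $k$ steps (no termination), and all computations other than (2) are exact. Each $\tilde v_i$ lies in the range of $Q$; $v_i\in\mathbb{R}^n$ is defined by $\tilde v_i=Qv_i$, $\hat v_i=(-1)^{i-1}v_i$, $\widehat V_k=(\hat v_1,\dots,\hat v_k)$, $\widehat U_k=(\hat u_1,\dots,\hat u_k)$. $\widehat B_k\in\mathbb{R}^{k\times k}$ is upper bidiagonal with diagonal $\hat\alpha_1,\dots,\hat\alpha_k$ and superdiagonal $\hat\beta_1,\dots,\hat\beta_{k-1}$. Convention: a bound $\mathcal{O}(\phi)$ means at most a constant times $\phi$ when $\kappa(C)\tau$ is sufficiently small, terms of higher order in $\tau$ being neglected; the constant is absolute, while the smallness threshold may depend on $m,n,p,k$. *)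

(* Defs.v *)
From mathcomp Require Import all_boot all_order all_algebra.
From mathcomp Require Import boolp classical_sets reals.
Set Implicit Arguments.
Unset Strict Implicit.
Unset Printing Implicit Defensive.
Import Order.TTheory GRing.Theory Num.Theory.
Local Open Scope ring_scope.

Definition dotv (R : realType) (r : nat) (x y : 'cV[R]_r) : R := (x^T *m y) 0 0.

Definition norm2 (R : realType) (r : nat) (x : 'cV[R]_r) : R :=
  Num.sqrt (dotv x x).

(* The supremum is over the closed unit ball, not the unit sphere, so that
   the set is nonempty also when M has no column. *)
Definition mxnorm2 (R : realType) (q r : nat) (M : 'M[R]_(q, r)) : R :=
  sup [set t | exists2 x : 'cV[R]_r, norm2 x <= 1 & t = norm2 (M *m x)]%classic.

Definition is_penrose_inverse (R : realType) (q r : nat)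
    (M : 'M[R]_(q, r)) (X : 'M[R]_(r, q)) : Prop :=
  [/\ M *m X *m M = M, X *m M *m X = X,
      (M *m X)^T = M *m X & (X *m M)^T = X *m M].

(* The Moore-Penrose inverse; mathcomp's pinvmx is only a one-sided partial
   inverse and does not satisfy the two symmetry equations. *)
Definition mpinv (R : realType) (q r : nat) (M : 'M[R]_(q, r)) : 'M[R]_(r, q) :=
  xget 0 [set X | is_penrose_inverse M X]%classic.

Definition cond2 (R : realType) (q r : nat) (M : 'M[R]_(q, r)) : R :=
  mxnorm2 M * mxnorm2 (mpinv M).

Definition upper_triangular (R : realType) (q r : nat) (M : 'M[R]_(q, r)) : Prop :=
  is_trig_mx M^T.

Definition is_compact_QR (R : realType) (q n : nat)
    (C Q : 'M[R]_(q, n)) (T : 'M[R]_n) : Prop :=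
  [/\ Q^T *m Q = 1%:M, upper_triangular T, T \in unitmx & C = Q *m T].

(* All the sequences keep the 1-based numbering of the algorithm: the value at
   index 0 is meaningful only for beta and betah, and values beyond the last
   step are irrelevant. The suffix h stands for a hat, vt for v-tilde and
   zb for z-bar. *)
Record rjbd_data (R : realType) (m n p : nat) := RjbdData {
  s0 : 'cV[R]_n;
  u : nat -> 'cV[R]_m;
  vt : nat -> 'cV[R]_(m + p);
  zb : nat -> 'cV[R]_n;
  s : nat -> 'cV[R]_(m + p);
  uh : nat -> 'cV[R]_p;
  alpha : nat -> R;
  beta : nat -> R;
  alphah : nat -> R;
  betah : nat -> R
}.

Definition ut (R : realType) (m n p : nat) (d : rjbd_data R m n p) (i : nat) :
  'cV[R]_(m + p) := col_mx (u d i) 0.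

Definition rb (R : realType) (m n p : nat) (C : 'M[R]_(m + p, n))
    (d : rjbd_data R m n p) (i : nat) : 'cV[R]_(m + p) :=
  ut d i - C *m zb d i.

(* In step_residual a zero residual (exact inner solution) is accepted for
   tau >= 0, because 0 / 0 = 0. *)
Record rjbd_step (R : realType) (m n p : nat) (C : 'M[R]_(m + p, n)) (tau : R)
    (d : rjbd_data R m n p) (i : nat) : Prop := RjbdStep {
  step_u : alpha d i *: u d i = usubmx (vt d i) - beta d i.-1 *: u d i.-1;
  step_u_norm : norm2 (u d i) = 1;
  step_residual :
    norm2 (C^T *m rb C d i) / (mxnorm2 C * norm2 (rb C d i)) <= tau;
  step_s : s d i = C *m zb d i - alpha d i *: vt d i;
  step_vt : beta d i *: vt d i.+1 =
    s d i - \sum_(1 <= j < i.+1) dotv (s d i) (vt d j) *: vt d j;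
  step_vt_norm : norm2 (vt d i.+1) = 1;
  step_uh : alphah d i *: uh d i =
    (-1) ^+ i.-1 *: dsubmx (vt d i) - betah d i.-1 *: uh d i.-1;
  step_uh_norm : norm2 (uh d i) = 1;
  step_betah : betah d i = alpha d i * beta d i / alphah d i;
  step_pos : [/\ 0 < alpha d i, 0 < beta d i, 0 < alphah d i & 0 < betah d i]
}.

Record is_rJBD (R : realType) (m n p : nat) (C : 'M[R]_(m + p, n)) (tau : R)
    (k : nat) (d : rjbd_data R m n p) : Prop := IsRJBD {
  rJBD_s0 : s0 d != 0;
  rJBD_vt1 : vt d 1 = (norm2 (C *m s0 d))^-1 *: (C *m s0 d);
  rJBD_beta0 : beta d 0 = 0;
  rJBD_betah0 : betah d 0 = 0;
  rJBD_steps : forall i : nat, (1 <= i <= k)%N -> rjbd_step C tau d i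
}.

Definition cols (R : realType) (r : nat) (f : nat -> 'cV[R]_r) (k : nat) :
  'M[R]_(r, k) := \matrix_(i < r, j < k) f j.+1 i 0.

Definition vhat (R : realType) (n : nat) (v : nat -> 'cV[R]_n) (i : nat) :
  'cV[R]_n := (-1) ^+ i.-1 *: v i.

Definition upper_bidiag (R : realType) (a b : nat -> R) (k : nat) : 'M[R]_k :=
  \matrix_(i < k, j < k)
    if i == j :> nat then a i.+1 else if j == i.+1 :> nat then b i.+1 else 0.

(* The i-th column of the identity matrix, with i counted from 1. *)
Definition ecol (R : realType) (r i : nat) : 'cV[R]_r :=
  \col_(j < r) (j.+1 == i)%:R.

(* Main.v *)
Require Import Defs.
From mathcomp Require Import all_boot all_order all_algebra.
From mathcomp Require Import boolp classical_sets reals.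
From mathcomp Require Import ring lra zify.
Import Order.TTheory GRing.Theory Num.Theory.

(** Write V, U for the matrices with columns v_1..v_k, u_1..u_k, B for the
    upper bidiagonal matrix of the alpha_i, beta_i, P for the diagonal matrix
    of alternating signs, so that V^ = V P, and e_i = Q^T r_i for the projected
    residual of the i-th inner least squares problem, with E = (e_1..e_k).  Let
    1_k be the last column of the identity matrix of order k.

    Reading the steps of the process backwards gives Q_A V = U B and
    Q_L V^ = U^ B^ at once.  Since Q^T C z_i = Q_A^T u_i - e_i, applying Q^T to
    the reorthogonalization step gives
      Q_A^T U = V (B^T + D) + beta_k v_{k+1} 1_k^T + E
    with D upper triangular, made of the reorthogonalization coefficients
    [rjbd_QAT_u].  The two blocks are coupled by Q_A^T Q_A + Q_L^T Q_L = I,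
    whence
      Q_L^T U^ B^ = Q_L^T Q_L V^ = V^ - Q_A^T U B P,
    and it remains to multiply by B^^-1 on the right [joint_bidiag_transfer].
    The coefficient of V^ there is H B^^-1 with H = I - P (B^T + D) B P upper
    Hessenberg; its subdiagonal alpha_i beta_i is that of B^^T B^, because
    beta^_i = alpha_i beta_i / alpha^_i and because the conjugation by P flips
    the sign.  So H - B^^T B^ is upper triangular, and D^ is its quotient by
    B^.  The remaining term is G^ = - E B P B^^-1.

    For the bound, the residual test controls C^T r_i, and a Penrose inverse X
    of C turns this into |e_i| <= kappa tau |r_i|  [norm2_QTr_le].  The part of
    r_i orthogonal to the range of Q has norm at most 1, so kappa tau <= 1/2
    forces |r_i| <= 2 and |e_i| <= 2 kappa tau.  Then beta_i <= 3, because
    beta_i is the inner product of v~_{i+1} with u~_i - r_i, and alpha_i <= 4 by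
    the first step.  Hence every column alpha_i e_i + beta_{i-1} e_{i-1} of E B
    has norm at most 14 kappa tau, and its Frobenius norm gains a factor
    sqrt k <= sqrt n, the v_i being orthonormal in R^n.  Estimating
    E B column by column, rather than by |E| |B|, matters: the inexact solves
    destroy the orthogonality of the u_i, which would be the way to bound |B|. *)
Local Open Scope ring_scope.

Set Implicit Arguments.
Unset Strict Implicit.
Unset Printing Implicit Defensive.

(** * Euclidean norm and operator norm *)

Lemma dotvE (R : realType) r (x y : 'cV[R]_r) :
  dotv x y = \sum_i x i 0 * y i 0.
Proof. by rewrite /dotv mxE; apply: eq_bigr => i _; rewrite mxE. Qed.

Lemma dotvC (R : realType) r (x y : 'cV[R]_r) : dotv x y = dotv y x.
Proof. by rewrite !dotvE; apply: eq_bigr => i _; rewrite mulrC. Qed.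

Lemma dotvDr (R : realType) r (x y z : 'cV[R]_r) :
  dotv x (y + z) = dotv x y + dotv x z.
Proof. by rewrite /dotv mulmxDr mxE. Qed.

Lemma dotvZr (R : realType) r (x : 'cV[R]_r) a y :
  dotv x (a *: y) = a * dotv x y.
Proof. by rewrite /dotv -scalemxAr mxE. Qed.

Lemma dotvNr (R : realType) r (x y : 'cV[R]_r) : dotv x (- y) = - dotv x y.
Proof. by rewrite -scaleN1r dotvZr mulN1r. Qed.

Lemma dotvDl (R : realType) r (x y z : 'cV[R]_r) :
  dotv (x + y) z = dotv x z + dotv y z.
Proof. by rewrite dotvC dotvDr !(dotvC z). Qed.

Lemma dotvZl (R : realType) r a (x y : 'cV[R]_r) :
  dotv (a *: x) y = a * dotv x y.
Proof. by rewrite dotvC dotvZr dotvC. Qed.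

Lemma dotvNl (R : realType) r (x y : 'cV[R]_r) : dotv (- x) y = - dotv x y.
Proof. by rewrite dotvC dotvNr dotvC. Qed.

Lemma dotv_sumr (R : realType) r (I : Type) (e : seq I) (P : pred I)
    (x : 'cV[R]_r) (F : I -> 'cV[R]_r) :
  dotv x (\sum_(i <- e | P i) F i) = \sum_(i <- e | P i) dotv x (F i).
Proof.
apply: (big_morph (dotv x)) => [y z|]; first exact: dotvDr.
by rewrite /dotv mulmx0 mxE.
Qed.

Lemma dotv_trmx (R : realType) q r (M : 'M[R]_(q, r)) x y :
  dotv (M^T *m x) y = dotv x (M *m y).
Proof. by rewrite /dotv trmx_mul trmxK mulmxA. Qed.

Lemma dotvv_ge0 (R : realType) r (x : 'cV[R]_r) : 0 <= dotv x x.
Proof. by rewrite dotvE; apply: sumr_ge0 => i _; rewrite -expr2 sqr_ge0. Qed.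

Lemma dotvv_eq0 (R : realType) r (x : 'cV[R]_r) : dotv x x = 0 -> x = 0.
Proof.
rewrite dotvE => /psumr_eq0P H; apply/matrixP => i j; rewrite ord1 mxE.
have /eqP := H (fun i _ => sqr_ge0 _) i isT.
by rewrite mulf_eq0 orbb => /eqP.
Qed.

Lemma norm2_ge0 (R : realType) r (x : 'cV[R]_r) : 0 <= norm2 x.
Proof. exact: sqrtr_ge0. Qed.

Lemma norm2_sqr (R : realType) r (x : 'cV[R]_r) : norm2 x ^+ 2 = dotv x x.
Proof. by rewrite sqr_sqrtr // dotvv_ge0. Qed.

Lemma norm2_eq0 (R : realType) r (x : 'cV[R]_r) : norm2 x = 0 -> x = 0.
Proof. by move=> x0; apply: dotvv_eq0; rewrite -norm2_sqr x0 expr0n. Qed.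

Lemma norm2Z (R : realType) r a (x : 'cV[R]_r) : norm2 (a *: x) = `|a| * norm2 x.
Proof.
by rewrite /norm2 dotvZl dotvZr mulrA -expr2 sqrtrM ?sqr_ge0 // sqrtr_sqr.
Qed.

Lemma norm2N (R : realType) r (x : 'cV[R]_r) : norm2 (- x) = norm2 x.
Proof. by rewrite -scaleN1r norm2Z normrN1 mul1r. Qed.

Lemma norm2_signr (R : realType) r i (x : 'cV[R]_r) :
  norm2 ((-1) ^+ i *: x) = norm2 x.
Proof. by rewrite norm2Z normr_sign mul1r. Qed.

Lemma cauchy_schwarz (R : realType) r (x y : 'cV[R]_r) :
  dotv x y <= norm2 x * norm2 y.
Proof.
suff H : dotv x y ^+ 2 <= (norm2 x * norm2 y) ^+ 2.
  have xy0 : 0 <= norm2 x * norm2 y by rewrite mulr_ge0 ?norm2_ge0.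
  apply: le_trans (ler_norm _) _.
  by rewrite -(ler_pXn2r (n := 2)) ?nnegrE // real_normK ?num_real.
rewrite exprMn !norm2_sqr; have := dotvv_ge0 y; rewrite le_eqVlt => /orP[/eqP/esym y0|y0].
  by rewrite (dotvv_eq0 y0) /dotv !mulmx0 !mxE mulr0 expr0n.
(* This vector is the component of x orthogonal to y, cleared of denominators;
   its squared norm is dotv y y times the gap in the inequality. *)
have := dotvv_ge0 (dotv y y *: x - dotv x y *: y).
rewrite !(dotvDl, dotvDr, dotvNl, dotvNr, dotvZl, dotvZr) (dotvC y x) => H.
rewrite -subr_ge0 -(pmulr_rge0 _ y0).
by apply: le_trans H _; rewrite le_eqVlt; apply/orP; left; apply/eqP; ring.
Qed.

Lemma ler_norm2D (R : realType) r (x y : 'cV[R]_r) :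
  norm2 (x + y) <= norm2 x + norm2 y.
Proof.
rewrite -(ler_pXn2r (n := 2)) ?nnegrE ?addr_ge0 ?norm2_ge0 //.
rewrite sqrrD !norm2_sqr dotvDl !dotvDr (dotvC y x).
have := cauchy_schwarz x y; lra.
Qed.

Lemma ler_norm2B (R : realType) r (x y : 'cV[R]_r) :
  norm2 (x - y) <= norm2 x + norm2 y.
Proof. by apply: le_trans (ler_norm2D _ _) _; rewrite norm2N. Qed.

Lemma norm2_usubmx (R : realType) m p (x : 'cV[R]_(m + p)) :
  norm2 (usubmx x) <= norm2 x.
Proof.
apply: ler_wsqrtr; rewrite -{3 4}(vsubmxK x) /dotv tr_col_mx mul_row_col.
by rewrite [leRHS]mxE lerDl; apply: dotvv_ge0.
Qed.

(** Cauchy-Schwarz row by row.  This bounds the set of which mxnorm2 is the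
    supremum, and gives the columnwise estimate [mxnorm2_col_le]. *)
Lemma norm2_mulmx_frob (R : realType) q r (M : 'M[R]_(q, r)) x :
  norm2 (M *m x) <= Num.sqrt (\sum_j norm2 (col j M) ^+ 2) * norm2 x.
Proof.
have S0 : 0 <= \sum_j norm2 (col j M) ^+ 2.
  by apply: sumr_ge0 => j _; apply: sqr_ge0.
rewrite -(ler_pXn2r (n := 2)) ?nnegrE ?mulr_ge0 ?sqrtr_ge0 ?norm2_ge0 //.
rewrite exprMn (sqr_sqrtr S0) norm2_sqr dotvE.
(* Sum the squared entries by rows, to match the entries of M *m x. *)
rewrite (eq_bigr (fun j => \sum_i M i j ^+ 2)); last first.
  move=> j _; rewrite norm2_sqr dotvE.
  by apply: eq_bigr => i _; rewrite mxE.
rewrite exchange_big mulr_suml; apply: ler_sum => i _ /=.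
have -> : (M *m x) i 0 = dotv (row i M)^T x.
  by rewrite dotvE mxE; apply: eq_bigr => j _; rewrite !mxE.
have -> : \sum_j M i j ^+ 2 = norm2 (row i M)^T ^+ 2.
  by rewrite norm2_sqr dotvE; apply: eq_bigr => j _; rewrite !mxE.
have := cauchy_schwarz (row i M)^T x.
have := cauchy_schwarz (- (row i M)^T) x; rewrite dotvNl norm2N.
nra.
Qed.

Lemma norm2_mulmx_unit_ball (R : realType) q r (M : 'M[R]_(q, r)) x :
  norm2 x <= 1 -> norm2 (M *m x) <= mxnorm2 M.
Proof.
move=> x1; apply: ub_le_sup; last by exists x.
exists (Num.sqrt (\sum_j norm2 (col j M) ^+ 2)) => _ [z z1 ->].
by apply: le_trans (norm2_mulmx_frob M z) _; rewrite ler_piMr ?sqrtr_ge0.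
Qed.

Lemma norm2_0 (R : realType) r : norm2 (0 : 'cV[R]_r) = 0.
Proof. by rewrite /norm2 /dotv mulmx0 mxE sqrtr0. Qed.

Lemma mxnorm2_ge0 (R : realType) q r (M : 'M[R]_(q, r)) : 0 <= mxnorm2 M.
Proof.
apply: le_trans (norm2_ge0 (M *m 0)) (norm2_mulmx_unit_ball M _).
by rewrite norm2_0.
Qed.

Lemma norm2_mulmx (R : realType) q r (M : 'M[R]_(q, r)) x :
  norm2 (M *m x) <= mxnorm2 M * norm2 x.
Proof.
have := norm2_ge0 x; rewrite le_eqVlt => /orP[/eqP/esym x0|x0].
  by rewrite x0 (norm2_eq0 x0) mulmx0 norm2_0 mulr0.
rewrite -ler_pdivrMr // mulrC.
have -> : (norm2 x)^-1 * norm2 (M *m x) = norm2 (M *m ((norm2 x)^-1 *: x)).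
  by rewrite -scalemxAr norm2Z ger0_norm // invr_ge0 ltW.
apply: norm2_mulmx_unit_ball; rewrite norm2Z ger0_norm ?invr_ge0 ?norm2_ge0 //.
by rewrite mulVf ?lt0r_neq0.
Qed.

Lemma mxnorm2_le (R : realType) q r (M : 'M[R]_(q, r)) b :
  (forall x, norm2 x <= 1 -> norm2 (M *m x) <= b) -> mxnorm2 M <= b.
Proof.
move=> H; apply: ge_sup => [|_ [x x1 ->]]; last exact: H.
by exists (norm2 (M *m 0)), 0 => //; rewrite norm2_0.
Qed.

Lemma mxnorm2M (R : realType) q r t (M : 'M[R]_(q, r)) (N : 'M[R]_(r, t)) :
  mxnorm2 (M *m N) <= mxnorm2 M * mxnorm2 N.
Proof.
apply: mxnorm2_le => x x1; rewrite -mulmxA; apply: le_trans (norm2_mulmx _ _) _.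
by rewrite ler_wpM2l ?mxnorm2_ge0 // norm2_mulmx_unit_ball.
Qed.

Lemma mxnorm2_col_le (R : realType) q r (M : 'M[R]_(q, r)) b :
  0 <= b -> (forall j, norm2 (col j M) <= b) -> mxnorm2 M <= Num.sqrt r%:R * b.
Proof.
move=> b0 Mb; apply: mxnorm2_le => x x1.
apply: le_trans (norm2_mulmx_frob M x) _.
apply: le_trans (ler_piMr (sqrtr_ge0 _) x1) _.
rewrite -{1}(ger0_norm b0) -sqrtr_sqr -sqrtrM ?ler0n //; apply: ler_wsqrtr.
have -> : r%:R * b ^+ 2 = \sum_(j < r) b ^+ 2.
  by rewrite sumr_const card_ord mulr_natl.
apply: ler_sum => j _.
by rewrite lerXn2r ?nnegrE ?norm2_ge0.
Qed.

Lemma dotv_orthonormal (R : realType) q n (Q : 'M[R]_(q, n)) x y :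
  Q^T *m Q = 1%:M -> dotv (Q *m x) (Q *m y) = dotv x y.
Proof. by move=> QQ; rewrite -dotv_trmx mulmxA QQ mul1mx. Qed.

Lemma norm2_orthonormal (R : realType) q n (Q : 'M[R]_(q, n)) x :
  Q^T *m Q = 1%:M -> norm2 (Q *m x) = norm2 x.
Proof. by move=> QQ; rewrite /norm2 dotv_orthonormal. Qed.

(** Pythagoras: Q Q^T x is the orthogonal projection of x on the range of Q. *)
Lemma norm2_orthocompl (R : realType) q n (Q : 'M[R]_(q, n)) x :
  Q^T *m Q = 1%:M -> norm2 (x - Q *m (Q^T *m x)) <= norm2 x.
Proof.
move=> QQ; apply: ler_wsqrtr.
rewrite !(dotvDl, dotvDr, dotvNl, dotvNr) dotv_orthonormal // (dotvC x (Q *m _)).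
rewrite -!dotv_trmx !trmxK dotvC -dotv_trmx.
have := dotvv_ge0 (Q^T *m x); lra.
Qed.

(** T^-1 Q^T satisfies the four Penrose equations, so the choice made by mpinv
    is a genuine Penrose inverse. *)
Lemma mpinv_compact_QR (R : realType) q n (C Q : 'M[R]_(q, n)) (T : 'M[R]_n) :
  is_compact_QR C Q T -> C *m mpinv C *m C = C.
Proof.
move=> [QQ _ uT CQT].
have [] // : is_penrose_inverse C (mpinv C).
apply: xgetPex; exists (invmx T *m Q^T); split.
- by rewrite CQT !mulmxA mulmxK // -[_ *m Q]mulmxA QQ mulmx1.
- rewrite CQT -!mulmxA (mulmxA Q^T) QQ mul1mx (mulmxA T) mulmxV // mul1mx.
  done.
- by rewrite CQT mulmxA mulmxK // trmx_mul trmxK.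
- by rewrite CQT -!mulmxA (mulmxA Q^T) QQ mul1mx mulVmx // trmx1.
Qed.

(** With X a Penrose inverse, C X C = C gives C X Q = Q, hence, for e = Q^T r,
    |e|^2 = <r, Q e> = <C^T r, X Q e> <= |C^T r| |X| |e|. *)
Lemma norm2_QTr_le (R : realType) q n (C Q : 'M[R]_(q, n)) (T : 'M[R]_n) r :
  is_compact_QR C Q T ->
  norm2 (Q^T *m r) <= mxnorm2 (mpinv C) * norm2 (C^T *m r).
Proof.
move=> qr; have := mpinv_compact_QR qr; case: qr => QQ _ uT CQT CXC.
have CXQ : C *m mpinv C *m Q = Q.
  by rewrite -[LHS](mulmxK uT) -(mulmxA _ Q) -CQT CXC CQT mulmxK.
set e := Q^T *m r.
have H : norm2 e * norm2 e <= (mxnorm2 (mpinv C) * norm2 (C^T *m r)) * norm2 e.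
  rewrite -expr2 norm2_sqr {1}/e dotv_trmx -CXQ -!mulmxA -dotv_trmx.
  apply: le_trans (cauchy_schwarz _ _) _.
  rewrite mulrAC (mulrC _ (norm2 (C^T *m _))) ler_wpM2l ?norm2_ge0 //.
  by rewrite -(norm2_orthonormal e QQ) norm2_mulmx.
have := norm2_ge0 e; rewrite le_eqVlt => /orP[/eqP <-|e0].
  by rewrite mulr_ge0 ?norm2_ge0 ?mxnorm2_ge0.
by rewrite -(ler_pM2r e0).
Qed.
(** |M^T x|^2 = <x, M M^T x>, so the transpose needs no norm of its own. *)
Lemma norm2_trmx_mulmx (R : realType) q r (M : 'M[R]_(q, r)) x :
  norm2 (M^T *m x) <= mxnorm2 M * norm2 x.
Proof.
have H : norm2 (M^T *m x) * norm2 (M^T *m x) <=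
    (mxnorm2 M * norm2 x) * norm2 (M^T *m x).
  rewrite -expr2 norm2_sqr dotv_trmx; apply: le_trans (cauchy_schwarz _ _) _.
  by rewrite mulrAC mulrC ler_wpM2r ?norm2_ge0 // norm2_mulmx.
have := norm2_ge0 (M^T *m x); rewrite le_eqVlt => /orP[/eqP <-|e0].
  by rewrite mulr_ge0 ?norm2_ge0 ?mxnorm2_ge0.
by rewrite -(ler_pM2r e0).
Qed.

(** * Bidiagonal and triangular matrices *)

Lemma upper_triangularP (R : realType) q r (M : 'M[R]_(q, r)) :
  (forall (i : 'I_q) (j : 'I_r), (j < i)%N -> M i j = 0) <-> upper_triangular M.
Proof.
split=> [H|/is_trig_mxP H i j /H]; last by rewrite mxE.
by apply/is_trig_mxP => i j ij; rewrite mxE H.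
Qed.

Lemma upper_bidiag_triangular (R : realType) (a b : nat -> R) k :
  upper_triangular (upper_bidiag a b k).
Proof.
apply/upper_triangularP => i j ji; rewrite mxE.
by rewrite [X in if X then _ else _]gtn_eqF // ltn_eqF // ltnW.
Qed.

Lemma upper_triangularM (R : realType) q r t
    (M : 'M[R]_(q, r)) (N : 'M[R]_(r, t)) :
  upper_triangular M -> upper_triangular N -> upper_triangular (M *m N).
Proof.
move=> /upper_triangularP HM /upper_triangularP HN.
apply/upper_triangularP => i j ji; rewrite mxE big1 // => l _.
have [li|il] := ltnP l i; first by rewrite HM ?mul0r.
by rewrite HN ?mulr0 // (leq_trans ji).
Qed.

Lemma sum_mul_upper_bidiag (R : realType) (a b h : nat -> R) k (j : 'I_k) :
  b 0%N = 0 ->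
  \sum_(l < k) h l.+1 * upper_bidiag a b k l j
    = h j.+1 * a j.+1 + h j * b j.
Proof.
move=> b0; rewrite (bigD1 j) //= mxE eqxx; congr (_ + _).
case: j => -[|j] jk /=.
  rewrite b0 mulr0 big1 // => l /negPf lj; rewrite mxE.
  by rewrite -val_eqE /= in lj; rewrite lj mulr0.
have jk' := ltnW jk.
rewrite (bigD1 (Ordinal jk')) /=; last by rewrite -val_eqE /= ltn_eqF.
rewrite mxE /= ltn_eqF // eqxx big1 ?addr0 // => l /andP[/negPf l1 /negPf l2].
rewrite mxE; rewrite -!val_eqE /= in l1 l2.
by rewrite l1 /= eqSS eq_sym l2 mulr0.
Qed.

Lemma sum_mul_upper_bidiagT (R : realType) (a b h : nat -> R) k (j : 'I_k) :
  \sum_(l < k) h l.+1 * upper_bidiag a b k j l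
    = h j.+1 * a j.+1 + (j.+1 < k)%:R * (h j.+2 * b j.+1).
Proof.
rewrite (bigD1 j) //= mxE eqxx; congr (_ + _).
have [jk|kj] := ltnP j.+1 k; last first.
  rewrite mul0r big1 // => l lj; rewrite mxE eq_sym val_eqE (negPf lj).
  by rewrite ltn_eqF ?mulr0 // (leq_trans (ltn_ord l)).
rewrite mul1r (bigD1 (Ordinal jk)) /=; last by rewrite -val_eqE /= gtn_eqF.
rewrite mxE /= ltn_eqF // eqxx big1 ?addr0 // => l /andP[/negPf l1 /negPf l2].
rewrite mxE; rewrite -!val_eqE /= in l1 l2.
by rewrite eq_sym l1 l2 mulr0.
Qed.

(** Below the diagonal a Gram matrix of an upper bidiagonal matrix keeps only
    the products a_j b_j: this is what ties the two bidiagonal matrices. *)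
Lemma upper_bidiag_gram_subdiag (R : realType) (a b : nat -> R) k (i j : 'I_k) :
  b 0%N = 0 -> (j < i)%N ->
  ((upper_bidiag a b k)^T *m upper_bidiag a b k) i j
    = (i == j.+1 :> nat)%:R * (a j.+1 * b j.+1).
Proof.
move=> b0 ji; rewrite mxE.
(* h l.+1 is the entry (l, i) of the bidiagonal matrix. *)
pose h x := if x == i.+1 then a x else if i.+1 == x.+1 then b x else 0.
rewrite (eq_bigr (fun l : 'I_k => h l.+1 * upper_bidiag a b k l j)); last first.
  by move=> l _; rewrite !mxE.
rewrite sum_mul_upper_bidiag // /h !eqSS.
rewrite (ltn_eqF ji) (ltn_eqF (leqW ji)) (gtn_eqF ji) mul0r addr0.
by case: eqP => _; rewrite ?mul0r // mul1r mulrC.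
Qed.

Lemma upper_bidiag_unit (R : realType) (a b : nat -> R) k :
  (forall i, (1 <= i <= k)%N -> a i != 0) -> upper_bidiag a b k \in unitmx.
Proof.
move=> a0; rewrite unitmxE -det_tr det_trig; last exact: upper_bidiag_triangular.
by rewrite unitfE; apply/prodf_neq0 => i _; rewrite !mxE eqxx a0 /=.
Qed.

(** Column j of the product is a combination of columns j - 1 and j of X, so the
    vanishing below the diagonal propagates from left to right. *)
Lemma upper_triangular_bidiag_cancel (R : realType) (a b : nat -> R) q k
    (X : 'M[R]_(q, k)) :
  b 0%N = 0 -> (forall i, (1 <= i <= k)%N -> a i != 0) ->
  upper_triangular (X *m upper_bidiag a b k) -> upper_triangular X.
Proof.
move=> b0 a0 /upper_triangularP H; apply/upper_triangularP => i.
(* Row i of X with 1-based column numbers; the junk value h 0 is killed by b 0 = 0. *)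
pose h x := if insub x.-1 is Some l then X i l else 0.
have hE (l : 'I_k) : h l.+1 = X i l by rewrite /h /= valK.
have XB (j : 'I_k) :
    (X *m upper_bidiag a b k) i j = h j.+1 * a j.+1 + h j * b j.
  rewrite mxE -sum_mul_upper_bidiag //.
  by apply: eq_bigr => l _; rewrite hE.
suff Hj j : (j < k)%N -> (j < i)%N -> h j.+1 = 0.
  by move=> j ji; rewrite -hE Hj.
elim: j => [|j IH] jk ji; have /eqP := H i (Ordinal jk) ji; rewrite XB /=.
  by rewrite b0 mulr0 addr0 mulf_eq0 (negPf (a0 1%N _)) // orbF => /eqP.
rewrite IH ?(ltnW jk) ?(ltnW ji) // mul0r addr0.
by rewrite mulf_eq0 (negPf (a0 j.+2 _)) // orbF => /eqP.
Qed.

(** * Matrices given by their columns *)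

Lemma eq_cols (R : realType) r (f g : nat -> 'cV[R]_r) k :
  (forall i, (1 <= i <= k)%N -> f i = g i) -> cols f k = cols g k.
Proof. by move=> H; apply/matrixP => i j; rewrite !mxE H /=. Qed.

Lemma colsD (R : realType) r (f g : nat -> 'cV[R]_r) k :
  cols f k + cols g k = cols (fun i => f i + g i) k.
Proof. by apply/matrixP => i j; rewrite !mxE. Qed.

Lemma mulmx_cols (R : realType) q r (M : 'M[R]_(q, r)) (f : nat -> 'cV[R]_r) k :
  M *m cols f k = cols (fun i => M *m f i) k.
Proof.
by apply/matrixP => i j; rewrite !mxE; apply: eq_bigr => l _; rewrite mxE.
Qed.

Lemma col_cols (R : realType) r (f : nat -> 'cV[R]_r) k (j : 'I_k) :
  col j (cols f k) = f j.+1.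
Proof. by apply/matrixP => i l; rewrite !mxE ord1. Qed.

Lemma cols_mul_upper_bidiag (R : realType) r (g : nat -> 'cV[R]_r)
    (a b : nat -> R) k :
  b 0%N = 0 ->
  cols g k *m upper_bidiag a b k
    = cols (fun i => a i *: g i + b i.-1 *: g i.-1) k.
Proof.
move=> b0; apply/matrixP => i j; rewrite !mxE.
rewrite (eq_bigr (fun l : 'I_k => (g l.+1 i 0) * upper_bidiag a b k l j)).
  rewrite (sum_mul_upper_bidiag _ (fun l => g l i 0)) //.
  by rewrite (mulrC (a _)) (mulrC (b _)).
by move=> l _; rewrite mxE.
Qed.

(** The last column of the product with the transpose lacks its term in g_{k+1},
    which the rank one matrix restores. *)
Lemma cols_mul_upper_bidiagT (R : realType) r (g : nat -> 'cV[R]_r)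
    (a b : nat -> R) k :
  cols g k *m (upper_bidiag a b k)^T + b k *: (g k.+1 *m (ecol R k k)^T)
    = cols (fun i => a i *: g i + b i *: g i.+1) k.
Proof.
apply/matrixP => i j; rewrite !mxE big_ord1 !mxE.
rewrite (eq_bigr (fun l : 'I_k => (g l.+1 i 0) * upper_bidiag a b k j l)).
  rewrite (sum_mul_upper_bidiagT _ _ (fun l => g l i 0)).
  have := ltn_ord j; rewrite leq_eqVlt => /orP[/eqP jk|jk].
    have -> : (j.+1 < k)%N = false by rewrite jk ltnn.
    have -> : (j.+1 == k) = true by rewrite jk eqxx.
    rewrite mul0r addr0 mulr1 (mulrC (a _)); congr (_ + _).
    by move: (j : nat) jk => {}j ->.
  rewrite jk mul1r (ltn_eqF jk) !mulr0 addr0.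
  by rewrite (mulrC (a _)) (mulrC (b _)).
by move=> l _; rewrite !mxE.
Qed.
(** * From the bidiagonalization of one block to that of the other *)

Definition alt_sign_mx (R : realType) k : 'M[R]_k := diag_mx (\row_(i < k) (-1) ^+ i).

Lemma alt_sign_mxK (R : realType) k : alt_sign_mx R k *m alt_sign_mx R k = 1%:M.
Proof.
rewrite mul_diag_mx; apply/matrixP => i j; rewrite !mxE.
by have [->|] := eqVneq i j; rewrite ?mulr0 // !mulr1n -expr2 sqrr_sign.
Qed.

Lemma cols_vhat (R : realType) n (v : nat -> 'cV[R]_n) k :
  cols (vhat v) k = cols v k *m alt_sign_mx R k.
Proof.
by rewrite mul_mx_diag; apply/matrixP => i j; rewrite !mxE mulrC.
Qed.

Lemma alt_sign_conj (R : realType) k (M : 'M[R]_k) (i j : 'I_k) :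
  (alt_sign_mx R k *m M *m alt_sign_mx R k) i j = (-1) ^+ (i + j) * M i j.
Proof.
by rewrite mul_mx_diag mxE mul_diag_mx !mxE mulrAC exprD.
Qed.

Lemma ecol_mul (R : realType) k r (M : 'M[R]_(k, r)) (j : 'I_k) i :
  j.+1 = i -> (ecol R k i)^T *m M = row j M.
Proof.
move=> <-; rewrite rowE; congr (_ *m _); apply/matrixP => l t.
by rewrite !mxE ord1 eqxx eqSS.
Qed.

Lemma ecol_upper_bidiag (R : realType) (a b : nat -> R) k : (0 < k)%N ->
  (ecol R k k)^T *m upper_bidiag a b k = a k *: (ecol R k k)^T.
Proof.
case: k => // k _; rewrite (@ecol_mul _ _ _ _ ord_max) //.
apply/matrixP => i j; rewrite !mxE /= eqSS eq_sym.
case: eqP => _; rewrite ?mulr1 // (ltn_eqF (ltn_ord j)) mulr0 //.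
Qed.

Lemma ecol_alt_sign (R : realType) k : (0 < k)%N ->
  (ecol R k k)^T *m alt_sign_mx R k = (-1) ^+ k.-1 *: (ecol R k k)^T.
Proof.
case: k => // k _; rewrite (@ecol_mul _ _ _ _ ord_max) //.
apply/matrixP => i j; rewrite !mxE /= eqSS eq_sym -val_eqE /=.
by case: eqP; rewrite ?mulr1n ?mulr1 ?mulr0.
Qed.

(** The coupling Q_A^T Q_A + Q_L^T Q_L = I transfers a bidiagonalization of Q_A,
    perturbed by D and E, to Q_L.  The hypothesis on the products of the
    coefficients makes the two Hessenberg matrices agree below the diagonal,
    and E enters the result only through E B P B^^-1. *)
Lemma joint_bidiag_transfer (R : realType) m n p k (a b ah bh : nat -> R)
    (QA : 'M[R]_(m, n)) (QL : 'M[R]_(p, n)) (V : 'M[R]_(n, k))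
    (U : 'M[R]_(m, k)) (Uh : 'M[R]_(p, k)) (D : 'M[R]_k) (w : 'cV[R]_n)
    (E : 'M[R]_(n, k)) :
  let B := upper_bidiag a b k in
  let Bh := upper_bidiag ah bh k in
  let P := alt_sign_mx R k in
  (0 < k)%N -> b 0%N = 0 -> bh 0%N = 0 ->
  (forall i, (1 <= i <= k)%N -> ah i != 0) ->
  (forall i, (1 <= i <= k)%N -> ah i * bh i = a i * b i) ->
  QA^T *m QA + QL^T *m QL = 1%:M ->
  QA *m V = U *m B ->
  QA^T *m U = V *m (B^T + D) + b k *: (w *m (ecol R k k)^T) + E ->
  QL *m (V *m P) = Uh *m Bh ->
  upper_triangular D ->
  exists2 Dh, upper_triangular Dh &
    QL^T *m Uh = V *m P *m (Bh^T + Dh)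
                 + bh k *: ((-1) ^+ k *: w *m (ecol R k k)^T)
                 + - (E *m B *m P *m invmx Bh).
Proof.
move=> B Bh P k0 b0 bh0 ah0 abh QAL QAV QAU QLV uD.
have uBh : Bh \in unitmx by apply: upper_bidiag_unit.
(* F stands for Dh Bh; it is triangular by the agreement of the subdiagonals.
   It is kept abstract so that rewriting does not expand it. *)
have [F FE] : exists F, F = 1%:M - P *m ((B^T + D) *m B) *m P - Bh^T *m Bh.
  by eexists.
exists (F *m invmx Bh).
  apply: (upper_triangular_bidiag_cancel bh0 ah0); rewrite mulmxKV //.
  apply/upper_triangularP => i j ji.
  have /upper_triangularP DB0 := upper_triangularM uD (upper_bidiag_triangular a b k).
  have -> : F i j = - ((-1) ^+ (i + j) * ((B^T *m B) i j + (D *m B) i j))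
      - (Bh^T *m Bh) i j.
    rewrite FE mulmxDl -addrA mxE [X in X + _]mxE -val_eqE (gtn_eqF ji) add0r.
    by rewrite mxE [X in X + _]mxE alt_sign_conj mxE [X in _ + X]mxE.
  rewrite DB0 // addr0 !upper_bidiag_gram_subdiag //.
  have [ij|_] := eqVneq (i : nat) j.+1; last by rewrite !mul0r mulr0 oppr0 addr0.
  rewrite !mul1r abh ?ltn_ord // ij addSn exprS addnn -mul2n exprM sqrrN !expr1n.
  by ring.
(* The identity is checked after multiplication by the invertible Bh. *)
apply: (can_inj (mulmxK uBh)).
have -> : QL^T *m Uh *m Bh = V *m P - QA^T *m U *m B *m P.
  rewrite -mulmxA -QLV -(mulmxA _ U) -QAV.
  have -> : QL^T *m (QL *m (V *m P)) = QL^T *m QL *m (V *m P) by rewrite mulmxA.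
  rewrite -[QL^T *m QL](addKr (QA^T *m QA)) QAL addrC mulmxBl mul1mx.
  by rewrite !mulmxA.
rewrite QAU !mulmxDl mulNmx.
rewrite mulmxKV // -(mulmxA _ _ Bh) (mulmxDl Bh^T) mulmxKV //.
have -> : Bh^T *m Bh + F = 1%:M - P *m ((B^T + D) *m B) *m P.
  by rewrite FE addrC subrK.
have -> : V *m P *m (1%:M - P *m ((B^T + D) *m B) *m P)
    = V *m P - V *m (B^T + D) *m B *m P.
  rewrite mulmxBr mulmx1; congr (_ - _).
  by rewrite !mulmxA -(mulmxA V P P) alt_sign_mxK mulmx1.
have -> : b k *: (w *m (ecol R k k)^T) *m B *m P
    = ((-1) ^+ k.-1 * (a k * b k)) *: (w *m (ecol R k k)^T).
  rewrite -!scalemxAl -(mulmxA w) ecol_upper_bidiag // -scalemxAr -scalemxAl.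
  rewrite -mulmxA ecol_alt_sign // -scalemxAr !scalerA.
  by congr (_ *: _); ring.
have -> : bh k *: ((-1) ^+ k *: w *m (ecol R k k)^T) *m Bh
    = - ((-1) ^+ k.-1 * (a k * b k)) *: (w *m (ecol R k k)^T).
  rewrite -scalemxAl -mulmxA ecol_upper_bidiag // -scalemxAr -scalemxAl !scalerA.
  rewrite -abh ?k0 ?leqnn //; case: (k) k0 => // k' _; rewrite exprS.
  by congr (_ *: _); rewrite /=; ring.
rewrite scaleNr !opprD -!addrA.
by rewrite mulmxDr !mulmxDl.
Qed.

(** * The rJBD process *)

Lemma rjbd_step_tau_ge0 (R : realType) m n p (C : 'M[R]_(m + p, n)) tau d i :
  rjbd_step C tau d i -> 0 <= tau.
Proof.
move=> st; apply: le_trans (step_residual st).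
by rewrite divr_ge0 ?mulr_ge0 ?norm2_ge0 ?mxnorm2_ge0.
Qed.

(** If the denominator of the residual test is 0, the test says nothing, but then
    C^T r = 0 because |C^T r| <= |C| |r|. *)
Lemma rjbd_step_residual (R : realType) m n p (C : 'M[R]_(m + p, n)) tau d i :
  rjbd_step C tau d i ->
  norm2 (C^T *m rb C d i) <= tau * (mxnorm2 C * norm2 (rb C d i)).
Proof.
move=> st; have := step_residual st.
have : 0 <= mxnorm2 C * norm2 (rb C d i) by rewrite mulr_ge0 ?norm2_ge0 ?mxnorm2_ge0.
rewrite le_eqVlt => /orP[/eqP D0 _|D0]; last by rewrite ler_pdivrMr.
by rewrite -D0 mulr0; have := norm2_trmx_mulmx C (rb C d i); rewrite -D0.
Qed.

Lemma norm2_ut (R : realType) m n p (d : rjbd_data R m n p) i :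
  norm2 (ut d i) = norm2 (u d i).
Proof.
by rewrite /norm2 /dotv /ut tr_col_mx mul_row_col trmx0 mul0mx addr0.
Qed.

(** The component of r outside the range of Q is that of u~_i, of norm at most 1,
    whence |r| <= 1 + kappa tau |r|, which closes when kappa tau <= 1/2. *)
Lemma rjbd_residual_le (R : realType) m n p (C Q : 'M[R]_(m + p, n)) T tau d i :
  is_compact_QR C Q T -> rjbd_step C tau d i -> cond2 C * tau <= 2^-1 ->
  norm2 (rb C d i) <= 2 /\ norm2 (Q^T *m rb C d i) <= 2 * (cond2 C * tau).
Proof.
move=> qr st small; set r := rb C d i.
have eb : norm2 (Q^T *m r) <= cond2 C * tau * norm2 r.
  apply: le_trans (norm2_QTr_le r qr) _.
  have := rjbd_step_residual st; rewrite -/r => H.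
  apply: le_trans (ler_wpM2l (mxnorm2_ge0 _) H) _.
  by rewrite le_eqVlt /cond2; apply/orP; left; apply/eqP; ring.
have kt0 : 0 <= cond2 C * tau.
  by rewrite !mulr_ge0 ?mxnorm2_ge0 ?(rjbd_step_tau_ge0 st).
case: qr => QQ _ _ CQT.
have rE : r = (ut d i - Q *m (Q^T *m ut d i)) + Q *m (Q^T *m r).
  rewrite /r /rb CQT mulmxBr -!mulmxA (mulmxA Q^T) QQ mul1mx mulmxBr.
  by rewrite addrA subrK.
have r1 : norm2 r <= 1 + norm2 (Q^T *m r).
  rewrite {1}rE; apply: le_trans (ler_norm2D _ _) _.
  rewrite norm2_orthonormal // lerD2r; apply: le_trans (norm2_orthocompl _ QQ) _.
  by rewrite norm2_ut (step_u_norm st).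
have r0 := norm2_ge0 r.
have r2 : norm2 r <= 2 by nra.
by split=> //; nra.
Qed.

Lemma rjbd_u_rec (R : realType) m n p (C : 'M[R]_(m + p, n)) tau d
    (Q : 'M[R]_(m + p, n)) v i :
  rjbd_step C tau d i -> vt d i = Q *m v i ->
  usubmx Q *m v i = alpha d i *: u d i + beta d i.-1 *: u d i.-1.
Proof.
move=> st vi; rewrite (step_u st) subrK vi -{2}(vsubmxK Q) mul_col_mx.
by rewrite col_mxKu.
Qed.

Lemma rjbd_uh_rec (R : realType) m n p (C : 'M[R]_(m + p, n)) tau d
    (Q : 'M[R]_(m + p, n)) v i :
  rjbd_step C tau d i -> vt d i = Q *m v i ->
  dsubmx Q *m vhat v i = alphah d i *: uh d i + betah d i.-1 *: uh d i.-1.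
Proof.
move=> st vi; rewrite (step_uh st) subrK vi -{2}(vsubmxK Q) mul_col_mx.
by rewrite col_mxKd /vhat -scalemxAr.
Qed.

(** Full reorthogonalization is a Gram-Schmidt step, which is exact whatever the
    accuracy of the inner solves. *)
Lemma rjbd_vt_orthonormal (R : realType) m n p (C Q : 'M[R]_(m + p, n)) T tau k d :
  is_compact_QR C Q T -> is_rJBD C tau k d ->
  forall i j, (1 <= i <= k.+1)%N -> (1 <= j <= k.+1)%N ->
  dotv (vt d i) (vt d j) = (i == j)%:R.
Proof.
move=> [QQ _ uT CQT] [s00 vt1 _ _ st].
have vt1N : norm2 (vt d 1) = 1.
  rewrite vt1 norm2Z ger0_norm ?invr_ge0 ?norm2_ge0 // mulVf //.
  apply/eqP => /norm2_eq0; rewrite CQT -mulmxA => /(congr1 (mulmx Q^T)).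
  rewrite mulmxA QQ mul1mx mulmx0 => /(congr1 (mulmx (invmx T))).
  by rewrite mulKmx // mulmx0 => /eqP; rewrite (negPf s00).
have diag i : (1 <= i <= k.+1)%N -> dotv (vt d i) (vt d i) = 1.
  rewrite -norm2_sqr; case: i => // -[|i] ik; first by rewrite vt1N expr1n.
  by rewrite (step_vt_norm (st i.+1 _)) // expr1n.
suff lt N : (N <= k.+1)%N -> forall i j, (1 <= i)%N -> (i < j <= N)%N ->
    dotv (vt d j) (vt d i) = 0.
  move=> i j Hi Hj; have [ij|ji|->] := ltngtP i j; last exact: diag.
    by rewrite dotvC (lt k.+1) //; lia.
  by rewrite (lt k.+1) //; lia.
elim: N => [|N IH] Nk i j i1 ijN; first lia.
have [jN|Nj] := leqP j N; first by apply: IH; lia.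
have -> : j = N.+1 by lia.
have N1 : (1 <= N <= k)%N by lia.
have stN := st N N1; have [_ b0 _ _] := step_pos stN.
apply: (mulfI (lt0r_neq0 b0)); rewrite mulr0 -dotvZl (step_vt stN).
rewrite dotvC dotvDr dotvNr dotv_sumr (bigD1_seq i) ?iota_uniq //=; last first.
  by rewrite mem_index_iota; lia.
rewrite big_seq_cond big1 ?addr0 => [|l].
  by rewrite dotvZr diag ?mulr1 ?[dotv _ (s d N)]dotvC ?subrr //; lia.
move: (l : nat) => {}l; rewrite mem_index_iota => /andP[lN il]; rewrite dotvZr.
have [li|li|li] := ltngtP l i.
- by rewrite IH ?mulr0 //; lia.
- by rewrite (dotvC (vt d i)) IH ?mulr0 //; lia.
- by rewrite li eqxx in il.
Qed.

(** Write u~_i = C z_i + r_i and expand C z_i by steps (2)-(3) of the process,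
    then apply Q^T, which maps v~_j to v_j. *)
Lemma rjbd_QAT_u (R : realType) m n p (C Q : 'M[R]_(m + p, n)) tau d v i :
  Q^T *m Q = 1%:M -> rjbd_step C tau d i ->
  (forall j, (1 <= j <= i.+1)%N -> vt d j = Q *m v j) -> (0 < i)%N ->
  (usubmx Q)^T *m u d i =
    (alpha d i *: v i + beta d i *: v i.+1)
    + \sum_(1 <= j < i.+1) dotv (s d i) (vt d j) *: v j + Q^T *m rb C d i.
Proof.
move=> QQ st vtE i0.
have Qv j : (1 <= j <= i.+1)%N -> Q^T *m vt d j = v j.
  by move=> /vtE ->; rewrite mulmxA QQ mul1mx.
have -> : (usubmx Q)^T *m u d i = Q^T *m ut d i.
  by rewrite -{2}(vsubmxK Q) tr_col_mx mul_row_col mulmx0 addr0.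
have -> : ut d i = alpha d i *: vt d i + beta d i *: vt d i.+1
    + \sum_(1 <= j < i.+1) dotv (s d i) (vt d j) *: vt d j + rb C d i.
  have Cz : C *m zb d i = s d i + alpha d i *: vt d i by rewrite (step_s st) subrK.
  rewrite -(addrA (alpha d i *: _)) (step_vt st) subrK (addrC (alpha d i *: _)) -Cz.
  by rewrite /rb addrC subrK.
rewrite !mulmxDr -!scalemxAr !Qv ?leqnn ?i0 ?leqnSn //; congr (_ + _ + _).
rewrite mulmx_sumr; apply: eq_big_nat => j ji; rewrite -scalemxAr Qv //; lia.
Qed.

(** beta_i = <v~_{i+1}, s_i> = <v~_{i+1}, u~_i - r_i>, since v~_{i+1} is orthogonal
    to the vectors subtracted in forming both s_i and beta_i v~_{i+1}. *)
Lemma rjbd_beta_le (R : realType) m n p (C Q : 'M[R]_(m + p, n)) T tau k d i :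
  is_compact_QR C Q T -> is_rJBD C tau k d -> cond2 C * tau <= 2^-1 ->
  (i <= k)%N -> 0 <= beta d i <= 3.
Proof.
move=> qr rj small; case: i => [|i] ik.
  by rewrite (rJBD_beta0 rj) lexx ler0n.
have st := rJBD_steps rj (i := i.+1) ik.
have [_ b0 _ _] := step_pos st; rewrite ltW //=.
have orth := rjbd_vt_orthonormal qr rj.
have -> : beta d i.+1 = dotv (vt d i.+2) (ut d i.+1 - rb C d i.+1).
  have -> : ut d i.+1 - rb C d i.+1 = s d i.+1 + alpha d i.+1 *: vt d i.+1.
    by rewrite (step_s st) subrK /rb opprB addrC subrK.
  rewrite dotvDr dotvZr orth; [|lia|lia].
  rewrite gtn_eqF // mulr0 addr0.
  have /(congr1 (dotv (vt d i.+2))) := step_vt st.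
  rewrite dotvZr dotvDr dotvNr dotv_sumr orth ?eqxx // mulr1 => ->.
  rewrite big_nat_cond big1 ?subr0 // => j; rewrite andbT => ji.
  by rewrite dotvZr orth; [rewrite gtn_eqF ?mulr0 //|..]; lia.
apply: le_trans (cauchy_schwarz _ _) _; rewrite (step_vt_norm st) mul1r.
apply: le_trans (ler_norm2B _ _) _; rewrite norm2_ut (step_u_norm st).
by have [r2 _] := rjbd_residual_le qr st small; lra.
Qed.

(** 4 = 1 + 3: alpha_i u_i differs from a part of the unit vector v~_i by
    beta_{i-1} u_{i-1}. *)
Lemma rjbd_alpha_le (R : realType) m n p (C Q : 'M[R]_(m + p, n)) T tau k d i :
  is_compact_QR C Q T -> is_rJBD C tau k d -> cond2 C * tau <= 2^-1 ->
  (1 <= i <= k)%N -> 0 <= alpha d i <= 4.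
Proof.
move=> qr rj small ik; have st := rJBD_steps rj ik.
have [a0 _ _ _] := step_pos st; rewrite ltW //=.
have -> : alpha d i = norm2 (alpha d i *: u d i).
  by rewrite norm2Z (step_u_norm st) mulr1 gtr0_norm.
have /(rjbd_beta_le qr rj small) /andP[b0 b3] : (i.-1 <= k)%N by lia.
rewrite (step_u st); apply: le_trans (ler_norm2B _ _) _.
have vN : norm2 (vt d i) = 1.
  by rewrite /norm2 (rjbd_vt_orthonormal qr rj) ?eqxx ?sqrtr1 //; lia.
have bu : norm2 (beta d i.-1 *: u d i.-1) <= 3.
  rewrite norm2Z ger0_norm //; case: i ik {st a0 vN} b0 b3 => // -[|i] ik b0 b3.
    by rewrite (rJBD_beta0 rj) mul0r ler0n.
  by rewrite (step_u_norm (rJBD_steps rj (i := i.+1) _)) ?mulr1 //=; lia.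
by have := norm2_usubmx (vt d i); rewrite vN; lra.
Qed.

Lemma orthonormal_leq_dim (R : realType) n k (v : nat -> 'cV[R]_n) :
  (forall i j, (1 <= i <= k)%N -> (1 <= j <= k)%N ->
    dotv (v i) (v j) = (i == j)%:R) -> (k <= n)%N.
Proof.
move=> orth; apply: (@mulmx1_min R _ _ (cols v k)^T (cols v k)).
apply/matrixP => i j; rewrite mxE [RHS]mxE.
have := orth i.+1 j.+1 (ltn_ord i) (ltn_ord j); rewrite eqSS dotvE => <-.
by apply: eq_bigr => l _; rewrite !mxE.
Qed.

Unset Implicit Arguments.
Set Strict Implicit.

Theorem theorem4p7 (R : realType) :
  exists c : R, 0 < c /\
  forall m n p k : nat, (0 < k)%N ->
  exists eps : R, 0 < eps /\
  forall (A : 'M[R]_(m, n)) (L : 'M[R]_(p, n)) (Q : 'M[R]_(m + p, n))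
    (T : 'M[R]_n) (tau : R) (d : rjbd_data R m n p) (v : nat -> 'cV[R]_n),
  let C := col_mx A L in
  let QL := dsubmx Q in
  let Vh := cols (vhat v) k in
  let Uh := cols (uh d) k in
  let Bh := upper_bidiag (alphah d) (betah d) k in
  \rank C = n ->
  is_compact_QR C Q T ->
  is_rJBD C tau k d ->
  (forall i : nat, (1 <= i <= k.+1)%N -> vt d i = Q *m v i) ->
  QL *m Vh = Uh *m Bh /\
  exists Dh : 'M[R]_k, exists Gh : 'M[R]_(n, k),
    [/\ upper_triangular Dh,
        QL^T *m Uh = Vh *m (Bh^T + Dh)
                     + betah d k *: (vhat v k.+1 *m (ecol R k k)^T) + Gh
      & cond2 C * tau <= eps ->
        mxnorm2 Gh <=
          c * (mxnorm2 (invmx Bh) * Num.sqrt n%:R * (cond2 C * tau))].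
Proof.
(* 14 = (4 + 3) * 2, from alpha <= 4, beta <= 3 and |e_i| <= 2 kappa tau. *)
exists 14; split=> // m n p k k0; exists 2^-1; split; first by rewrite invr_gt0.
move=> A L Q T tau d v C QL Vh Uh Bh _ qr rj vE.
have [QQ _ _ _] := qr.
have st := rJBD_steps rj; have b0 := rJBD_beta0 rj; have bh0 := rJBD_betah0 rj.
have pos i ik := step_pos (st i ik).
have QLV : QL *m Vh = Uh *m Bh.
  rewrite mulmx_cols cols_mul_upper_bidiag //; apply: eq_cols => i ik.
  by rewrite (rjbd_uh_rec (st i ik)) // vE //; lia.
split=> //.
pose e i := Q^T *m rb C d i.
pose D : 'M[R]_k :=
  \matrix_(l, j) if (l <= j)%N then dotv (s d j.+1) (vt d l.+1) else 0.
have uD : upper_triangular D.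
  by apply/upper_triangularP => i j ji; rewrite mxE leqNgt ji.
have VD : cols v k *m D
    = cols (fun i => \sum_(1 <= j < i.+1) dotv (s d i) (vt d j) *: v j) k.
  apply/matrixP => i j; rewrite !mxE big_add1 summxE.
  rewrite (big_nat_widen _ _ k) ?ltn_ord // big_mkord [RHS]big_mkcond.
  apply: eq_bigr => l _; rewrite !mxE ltnS.
  by case: ifP => _; rewrite ?mulr0 // mulrC.
pose B := upper_bidiag (alpha d) (beta d) k; pose P := alt_sign_mx R k.
have [] := @joint_bidiag_transfer R m n p k (alpha d) (beta d) (alphah d) (betah d)
  (usubmx Q) QL (cols v k) (cols (u d) k) Uh D (v k.+1) (cols e k) k0 b0 bh0.
- by move=> i ik; have [_ _ a0 _] := pos i ik; rewrite lt0r_neq0.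
- move=> i ik; have [_ _ a0 _] := pos i ik.
  by rewrite (step_betah (st i ik)) mulrC divfK ?lt0r_neq0.
- by rewrite -mul_row_col -tr_col_mx vsubmxK.
- rewrite mulmx_cols cols_mul_upper_bidiag //; apply: eq_cols => i ik.
  by rewrite (rjbd_u_rec (st i ik)) // vE //; lia.
- rewrite mulmxDr (addrAC (_ *m _)) cols_mul_upper_bidiagT VD mulmx_cols !colsD.
  apply: eq_cols => i ik; apply: (rjbd_QAT_u QQ (st i ik)); last lia.
  by move=> l li; apply: vE; lia.
- by rewrite -cols_vhat QLV.
- exact: uD.
move=> Dh uDh QLU; exists Dh, (- (cols e k *m B *m P *m invmx Bh)); split=> //.
  by rewrite QLU /Vh cols_vhat.
move=> small.
have kt0 : 0 <= cond2 C * tau.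
  rewrite !mulr_ge0 ?mxnorm2_ge0 // (rjbd_step_tau_ge0 (st 1%N _)) //.
have eb i : (1 <= i <= k)%N -> norm2 (e i) <= 2 * (cond2 C * tau).
  by move=> ik; have [] := rjbd_residual_le qr (st i ik) small.
have kn : (k <= n)%N.
  apply: (@orthonormal_leq_dim R n k v) => i j ik jk.
  rewrite -(dotv_orthonormal (Q := Q)) // -!vE; try lia.
  by rewrite (rjbd_vt_orthonormal qr rj) //; lia.
have colb : mxnorm2 (- (cols e k *m B *m P)) <= Num.sqrt k%:R * (14 * (cond2 C * tau)).
  apply: mxnorm2_col_le => [|j]; first by rewrite mulr_ge0.
  rewrite cols_mul_upper_bidiag //.
  have -> : col j (- (cols (fun i => alpha d i *: e i + beta d i.-1 *: e i.-1) k *m P))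
      = - ((-1) ^+ j *: (alpha d j.+1 *: e j.+1 + beta d j *: e j)).
    by apply/matrixP => i l; rewrite ord1 mul_mx_diag !mxE mulrC.
  rewrite norm2N norm2_signr.
  have jk := ltn_ord j.
  have /andP[a0 a4] := rjbd_alpha_le qr rj small (i := j.+1) jk.
  have /andP[be0 be3] := rjbd_beta_le qr rj small (ltnW jk).
  have e1 : norm2 (alpha d j.+1 *: e j.+1) <= 4 * (2 * (cond2 C * tau)).
    by rewrite norm2Z ger0_norm // ler_pM ?norm2_ge0 // eb.
  have e2 : norm2 (beta d j *: e j) <= 3 * (2 * (cond2 C * tau)).
    (* The bound on e_j starts at j = 1; e_0 only occurs multiplied by beta_0 = 0. *)
    have [j0|j0] := posnP j; first by rewrite j0 b0 scale0r norm2_0; lra.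
    by rewrite norm2Z ger0_norm // ler_pM ?norm2_ge0 // eb // j0 ltnW.
  by apply: le_trans (ler_norm2D _ _) _; lra.
rewrite -mulNmx; apply: le_trans (mxnorm2M _ _) _.
apply: le_trans (ler_wpM2r (mxnorm2_ge0 _) colb) _.
have -> : 14 * (mxnorm2 (invmx Bh) * Num.sqrt n%:R * (cond2 C * tau))
    = Num.sqrt n%:R * (14 * (cond2 C * tau)) * mxnorm2 (invmx Bh) by ring.
rewrite ler_wpM2r ?mxnorm2_ge0 // ler_wpM2r //; first by rewrite mulr_ge0.
by rewrite ler_wsqrtr ?ler_nat.
Qed.
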